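(* Let $\beta>0$ and $c>0$ be fixed. There exists $\tilde\delta\in(0,1)$, independent of $n$, such that, with $\mu_n$-probability tending to $1$ as $n\to\infty$, the random graph $G$ drawn from $\mu_n$ satisfies $$e_{U,U^c}(G)\ \ge\ (1-\tilde\delta)\,c\,|U|\log n\qquad\text{for all } U\subseteq V \text{ with } |U|\le n/2 .$$
   Context: For each sufficiently large $n$, let $E=E_n=\lfloor \tfrac12 c\,n\log n\rfloor$ (so that the mean degree $2E/n$ is $c\log n$ up to rounding). Let $\mu_n$ be the probability measure on simple labelled graphs $G$ with vertex set $V=\{1,\dots,n\}$ and exactly $E$ edges given by $\mu_n(G)=\frac1Z\exp\big(-\beta\sum_{i=1}^n d_i^2\big)$, where $d_i$ is the degree of vertex $i$ in $G$ and $Z$ is the normalizing constant. For $U\subseteq V$, $e_{U,U^c}(G)$ denotes the number of edges of $G$ with one endpoint in $U$ and the other in $U^c=V\setminus U$. *)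

(* Defs.v *)
From mathcomp Require Import all_boot all_order all_algebra.
From mathcomp Require Import all_classical all_reals all_analysis.

Set Implicit Arguments.
Unset Strict Implicit.
Unset Printing Implicit Defensive.

Import Order.TTheory GRing.Theory Num.Theory.
Import numFieldNormedType.Exports.

Local Open Scope ring_scope.

(* The vertex set {1, ..., n} is represented by 'I_n, and a simple graph by its set of edges,
   each edge being an unordered pair of distinct vertices. *)

Definition graph (n : nat) : finType := {set {set 'I_n}}.

Definition vertex_pairs (n : nat) : {set {set 'I_n}} :=
  [set e : {set 'I_n} | #|e| == 2]%SET.

Definition graphs_with_edges (n m : nat) : {set graph n} :=
  [set G : {set {set 'I_n}} | (G \subset vertex_pairs n) && (#|G| == m)]%SET.

Definition degree (n : nat) (G : graph n) (i : 'I_n) : nat :=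
  #|[set e : {set 'I_n} in (G : {set {set 'I_n}}) | i \in e]%SET|.

Definition cut_size (n : nat) (G : graph n) (U : {set 'I_n}) : nat :=
  #|[set e : {set 'I_n} in (G : {set {set 'I_n}}) |
      [exists u in U, exists v in ~: U, e == [set u; v]]]%SET|.

Section GibbsMeasure.
Variable R : realType.

(* Num.truncn is the floor here: the argument is nonnegative when 0 <= c. *)
Definition num_edges (c : R) (n : nat) : nat :=
  Num.truncn (2^-1 * c * n%:R * ln n%:R).

Definition gibbs_weight (beta : R) (n : nat) (G : graph n) : R :=
  expR (- beta * \sum_(i < n) (degree G i)%:R ^+ 2).

Definition partition_function (beta c : R) (n : nat) : R :=
  \sum_(G in graphs_with_edges n (num_edges c n)) gibbs_weight beta G.

(* For the finitely many n at which no graph with num_edges c n edges exists,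
   the partition function vanishes and mu is identically 0 (see mu_total). *)
Definition mu (beta c : R) (n : nat) (A : {pred graph n}) : R :=
  (\sum_(G in graphs_with_edges n (num_edges c n) | G \in A)
     gibbs_weight beta G) / partition_function beta c n.

Lemma partition_function_gt0 (beta c : R) (n : nat) :
  (num_edges c n <= 'C(n, 2))%N -> 0 < partition_function beta c n.
Proof.
move=> le_m; have : (0 < #|graphs_with_edges n (num_edges c n)|)%N.
  by rewrite /graphs_with_edges cards_draws card_draws card_ord bin_gt0.
case/card_gt0P=> G0 G0in.
rewrite /partition_function (bigD1 G0) //= ltr_pwDl ?expR_gt0 //.
by apply: sumr_ge0 => G _; exact: expR_ge0.
Qed.

Lemma mu_total (beta c : R) (n : nat) :
  (num_edges c n <= 'C(n, 2))%N -> mu beta c (predT : {pred graph n}) = 1.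
Proof.
move=> /(partition_function_gt0 beta) Z_gt0; rewrite /mu.
under eq_bigl => G do rewrite andbT.
by rewrite -/(partition_function beta c n) divff // gt_eqF.
Qed.

End GibbsMeasure.

(* Main.v *)
(* Everything is a switching argument: an involutive local move that changes the Gibbs
   weight by a known factor, together with a double count of the moves leaving one event
   and entering another, bounds the ratio of the two weights; iterating the move makes
   the bound small.

   Degrees.  Suppose d_i >= 4y and d_j <= y.  Moving an edge from i to j lowers the sum of
   the squared degrees by at least 2y, and there are at least as many ways to do it as to
   undo it, so the weight drops by exp(-2 beta y), and this can be repeated y/2 times.
   With y and 16y on either side of the mean degree, y of order log n, this confines all
   degrees to (y, 64y), with a failure probability that survives the union over (i,j).

   Cuts.  Let |U| = k <= n/2, all degrees lie in (8z, 512z), and at most 2kz edges leave U.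
   Replacing uv inside U and xw outside U by ux and vw preserves all degrees, hence the
   weight, and raises the cut by 2.  There are of order (kz)(nz) such switches, whereas at
   most (cut)^2, of order (kz)^2, lead back, so each step gains a factor k/n.  About kz/2
   steps give (k/n)^(kz/2), which beats the binomial(n,k) <= e^k (n/k)^k choices of U. *)

Require Import Defs.
From mathcomp Require Import all_boot all_order all_algebra.
From mathcomp Require Import all_classical all_reals all_analysis.
From mathcomp Require Import zify ring lra.

Set Implicit Arguments.
Unset Strict Implicit.
Unset Printing Implicit Defensive.

Import Order.TTheory GRing.Theory Num.Theory.
Import numFieldNormedType.Exports.

Local Open Scope ring_scope.


(** * Weighted double counting of switches *)

(** Sum [rho * w (phi m x)] over the valid pairs [(x, m)] with [x] in [A]. Each [x] contributes at
    least [f] terms, each at least [w x]; seen from the image [y = phi m x], each [y] in [B] occurs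
    at most [g] times. *)
Lemma switching (R : numDomainType) (T M : finType) (phi : M -> T -> T)
    (w : T -> R) (A B : {set T}) (valid : T -> M -> bool) (f g : nat) (rho : R) :
  (forall m, involutive (phi m)) -> (forall x, 0 <= w x) -> 0 <= rho ->
  (forall x m, x \in A -> valid x m ->
     phi m x \in B /\ w x <= rho * w (phi m x)) ->
  (forall x, x \in A -> (f <= #|[set m | valid x m]|)%N) ->
  (forall y, y \in B ->
     (#|[set m | (phi m y \in A) && valid (phi m y) m]| <= g)%N) ->
  f%:R * \sum_(x in A) w x <= g%:R * rho * \sum_(x in B) w x.
Proof.
move=> phiK w0 rho0 step fwd bwd.
apply: (@le_trans _ _ (\sum_(x in A) \sum_(m | valid x m) rho * w (phi m x))).
  rewrite mulr_sumr; apply: ler_sum => x xA.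
  apply: (@le_trans _ _ (\sum_(m | valid x m) w x)).
    rewrite sumr_const -[X in _ <= X]mulr_natl.
    have le_f : f%:R <= #|valid x|%:R :> R by rewrite ler_nat -cardsE fwd.
    exact: (ler_wpM2r (w0 x) le_f).
  by apply: ler_sum => m vm; have [] := step x m xA vm.
rewrite (exchange_big_dep predT) //=.
apply: (@le_trans _ _ (\sum_m \sum_(y in B | (phi m y \in A) && valid (phi m y) m)
                         rho * w y)).
  apply: ler_sum => m _.
  (* Substitute [x = phi m y]: the move is its own inverse, so the sum now runs over the targets
     [y]. *)
  rewrite (reindex_inj (inv_inj (phiK m))) /=.
  rewrite le_eqVlt; apply/orP; left; apply/eqP.
  apply: eq_big => [y|y _]; last by rewrite phiK.
  case: (boolP (phi m y \in A)) => [yA|]; last by rewrite andbF.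
  case: (boolP (valid _ _)) => [v|]; last by rewrite !andbF.
  by have [] := step _ _ yA v; rewrite phiK => ->.
rewrite (exchange_big_dep (mem B)) //=; last by move=> m y _ /andP[].
rewrite mulr_sumr. apply: ler_sum => y yB.
rewrite (eq_bigl (fun m => m \in [set m | (phi m y \in A) && valid (phi m y) m]%SET)); last first.
  by move=> m; rewrite inE yB.
rewrite sumr_const -mulrA.
have le_g := bwd y yB; rewrite -(ler_nat R) in le_g.
apply: le_trans (ler_wpM2r (mulr_ge0 rho0 (w0 y)) le_g).
by rewrite mulr_natl.
Qed.

(** * Symmetric differences and fibre counting *)

Section Toggle.
Variable T : finType.
Implicit Types (S G A D : {set T}).

(** A symmetric difference, and not a deletion followed by an insertion: it is an involution on all
    sets, whether or not the move makes sense there, as [switching] demands. *)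
Definition toggle S G : {set T} := [set e | (e \in G) (+) (e \in S)].

Lemma toggleK S : involutive (toggle S).
Proof. by move=> G; apply/setP => e; rewrite !inE addbK. Qed.

(** Additive bookkeeping for any move, free of natural-number subtraction. The choice of [F] yields
    the change in the number of edges, in a degree or in a cut. *)
Lemma sum_toggle (F : T -> nat) D A G : D \subset G -> [disjoint A & G] ->
  (\sum_(e in toggle (D :|: A) G) F e + \sum_(e in D) F e =
   \sum_(e in G) F e + \sum_(e in A) F e)%N.
Proof.
move=> /fintype.subsetP DG dAG.
have notA e : e \in G -> e \notin A by move=> eG; rewrite (disjointFl dAG).
rewrite [X in (X + _ = _)%N]big_mkcond [X in (_ + X = _)%N]big_mkcond.
rewrite [X in (_ = X + _)%N]big_mkcond [X in (_ = _ + X)%N]big_mkcond.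
rewrite -!big_split /=; apply: eq_bigr => e _.
rewrite !inE; have := DG e; have := notA e.
by case: (e \in G); case: (e \in D); case: (e \in A) => //= h1 h2;
  rewrite ?addn0 ?add0n //; first [by have := h1 isT | by have := h2 isT].
Qed.

Lemma mem_toggle_added D A G e :
  [disjoint A & G] -> e \in A -> e \in toggle (D :|: A) G.
Proof. by move=> dAG eA; rewrite !inE eA orbT (disjointFr dAG). Qed.

End Toggle.

Lemma leq_card_fibres (S T : finType) (f : S -> T) (A : {set S}) (B : {set T})
    (k : nat) :
  {in A, forall a, f a \in B} ->
  {in B, forall b, #|[set a in A | f a == b]| <= k}%N ->
  (#|A| <= #|B| * k)%N.
Proof.
move=> AB fib; rewrite -sum1_card (partition_big f (mem B)) //=.
rewrite -sum_nat_const; apply: leq_sum => b bB.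
rewrite sum1_card; apply: leq_trans (fib b bB).
by rewrite cardsE.
Qed.

(** * Degrees and cuts as counts of pairs and as sums over edges *)

Section Graphs.
Variable n : nat.
Implicit Types (G : graph n) (U : {set 'I_n}).

Lemma pair_inj (i : 'I_n) : injective (fun v => [set i; v]%SET).
Proof.
move=> v v' /= e.
have : v \in [set i; v']%SET by rewrite -e !inE eqxx orbT.
rewrite !inE => /orP[/eqP vi|/eqP //].
have : v' \in [set i; v]%SET by rewrite e !inE eqxx orbT.
by rewrite !inE vi orbb => /eqP.
Qed.

Definition nbrs G (i : 'I_n) : {set 'I_n} := [set v | [set i; v]%SET \in G]%SET.

(** Ordered pairs: the endpoint in [U] comes first, so a cut edge occurs once here, whereas an edge
    inside [U] occurs in [inner] in both orientations. *)
Definition cross G U : {set 'I_n * 'I_n} :=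
  [set p | [&& p.1 \in U, p.2 \notin U & [set p.1; p.2]%SET \in G]]%SET.

Definition inner G U : {set 'I_n * 'I_n} :=
  [set p | [&& p.1 \in U, p.2 \in U & [set p.1; p.2]%SET \in G]]%SET.

Lemma set2E (i u v : 'I_n) : (i \in [set u; v]%SET) = (i == u) || (i == v).
Proof. by rewrite !inE. Qed.

Lemma edge_neq G u v : G \subset vertex_pairs n -> [set u; v]%SET \in G -> u != v.
Proof. by move=> /fintype.subsetP /[apply]; rewrite inE cards2; case: (u == v). Qed.

Lemma degreeE G i : G \subset vertex_pairs n -> degree G i = #|nbrs G i|.
Proof.
move=> GP; rewrite /degree -(card_imset _ (@pair_inj i)); congr #|pred_of_set _|.
apply/setP => e; rewrite inE; apply/andP/imsetP; first move=> [eG ie].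
  have := fintype.subsetP GP e eG; rewrite inE => /cards2P[a [b [ab ee]]].
  move: ie; rewrite ee set2E => /orP[]/eqP ii.
    by exists b; [rewrite inE ii -ee | rewrite ii].
  by exists a; [rewrite inE ii finset.setUC -ee | rewrite ii finset.setUC].
by move=> [v]; rewrite inE => vG ->; rewrite vG set2E eqxx.
Qed.

Lemma cut_sizeE G U : cut_size G U = #|cross G U|.
Proof.
rewrite /cut_size.
rewrite -(@card_in_imset _ _ (fun p : 'I_n * 'I_n => [set p.1; p.2]%SET)); last first.
  move=> [u v] [u' v'] /=; rewrite !inE /= => /and3P[uU vU _] /and3P[u'U v'U _] e.
  have : u \in [set u'; v']%SET by rewrite -e set2E eqxx.
  rewrite set2E => /orP[/eqP uu|/eqP uv]; last by rewrite -uv uU in v'U.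
  by move: e; rewrite uu => /pair_inj ->.
congr #|pred_of_set _|; apply/setP => e; rewrite inE.
apply/andP/imsetP => [[eG /exists_inP[u uU /exists_inP[v vU /eqP ee]]]|[[u v]]].
  by exists (u, v); rewrite // inE /= uU -ee eG andbT; move: vU; rewrite inE.
rewrite inE /= => /and3P[uU vU uvG ->]; split=> //.
by apply/exists_inP; exists u => //; apply/exists_inP; exists v; rewrite ?inE.
Qed.

Lemma card_dep_pairs (U : {set 'I_n}) (F : 'I_n -> {set 'I_n}) :
  (\sum_(u in U) #|F u| = #|[set p : 'I_n * 'I_n | (p.1 \in U) && (p.2 \in F p.1)]%SET|)%N.
Proof.
rewrite -sum1_card (eq_bigl (fun p : 'I_n * 'I_n => (p.1 \in U) && (p.2 \in F p.1))); last first.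
  by move=> p; rewrite inE.
rewrite -(pair_big_dep (mem U) (fun u v => v \in F u) (fun _ _ => 1%N)) /=.
by apply: eq_bigr => u _; rewrite sum1_card.
Qed.

(** Split the neighbours of each vertex of [U] by whether they lie in [U]. With degrees bounded
    below, a small cut thus forces many inner edges. *)
Lemma sum_degree_cut G U : G \subset vertex_pairs n ->
  (\sum_(u in U) degree G u = #|inner G U| + cut_size G U)%N.
Proof.
move=> GP; rewrite cut_sizeE (eq_bigr (fun u => #|nbrs G u|)); last first.
  by move=> u _; rewrite degreeE.
rewrite card_dep_pairs -cardsUI [X in (_ = _ + X)%N]eq_card0 ?addn0; last first.
  by move=> p; rewrite !inE; case: (p.2 \in U); rewrite !andbF.
by congr #|pred_of_set _|; apply/setP => p; rewrite !inE;
  case: (p.1 \in U); case: (p.2 \in U); rewrite /= ?orbF.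
Qed.

Lemma cut_sizeC G U : cut_size G (~: U) = cut_size G U.
Proof.
rewrite !cut_sizeE -(@card_imset _ _ (fun p : 'I_n * 'I_n => (p.2, p.1))); last first.
  by move=> [? ?] [? ?] [-> ->].
congr #|pred_of_set _|; apply/setP => -[u v].
apply/imsetP/idP => [[[x w]]|].
  rewrite !inE /= => /and3P[xU wU xwG] [-> ->].
  by rewrite negbK in wU; rewrite wU xU finset.setUC xwG.
rewrite !inE /= => /and3P[uU vU uvG]; exists (v, u) => //.
by rewrite !inE /= negbK uU vU finset.setUC.
Qed.

Lemma sum_degree G : G \subset vertex_pairs n ->
  (\sum_i degree G i = 2 * #|G|)%N.
Proof.
move=> GP.
transitivity (\sum_(i : 'I_n) \sum_(e in G) (i \in e) : nat)%N.
  apply: eq_bigr => i _; rewrite /degree -sum1_card big_mkcond [RHS]big_mkcond.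
  by apply: eq_bigr => e _; rewrite inE; case: (e \in G); case: (i \in e).
rewrite exchange_big /= mulnC -sum_nat_const; apply: eq_bigr => e eG.
have := fintype.subsetP GP e eG; rewrite inE => /eqP e2; transitivity #|e|; last exact: e2.
by rewrite -sum1_card [RHS]big_mkcond; apply: eq_bigr => i _; case: (i \in e).
Qed.

Lemma degree_sumE G i : degree G i = (\sum_(e in G) (i \in e))%N.
Proof.
rewrite /degree -sum1_card big_mkcond [RHS]big_mkcond.
by apply: eq_bigr => e _; rewrite inE; case: (e \in G); case: (i \in e).
Qed.

(** The condition inside [cut_size], isolated so that a cut, like a degree, becomes a sum over edges
    to which [sum_toggle] applies. *)
Definition cutting U (e : {set 'I_n}) : bool :=
  [exists u in U, exists v in ~: U, e == [set u; v]%SET].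

Lemma cut_size_sumE G U : cut_size G U = (\sum_(e in G) cutting U e)%N.
Proof.
rewrite /cut_size -sum1_card big_mkcond [RHS]big_mkcond.
by apply: eq_bigr => e _; rewrite inE -/(cutting U e);
   case: (e \in G); case: (cutting U e).
Qed.

Lemma cuttingE U u v : cutting U [set u; v]%SET = (u \in U) (+) (v \in U).
Proof.
apply/exists_inP/idP => [[a aU /exists_inP[b]]|].
  rewrite inE => bU /eqP e.
  have : u \in [set a; b]%SET by rewrite -e set2E eqxx.
  rewrite set2E => /orP[]/eqP ua.
    by move: e; rewrite ua => /pair_inj ->; rewrite aU (negbTE bU).
  by move: e; rewrite ua [RHS]finset.setUC => /pair_inj ->;
     rewrite aU (negbTE bU).
case: (boolP (u \in U)) => uU; case: (boolP (v \in U)) => vU //= _.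
  by exists u => //; apply/exists_inP; exists v; rewrite ?inE.
by exists v => //; apply/exists_inP; exists u; rewrite ?inE // finset.setUC.
Qed.

End Graphs.


(** * Gibbs weights, edge moves and concentration of degrees *)

(** Bounds from below the number of edges at [i] that can be moved to [j]: the other endpoint must
    not already be adjacent to [j], nor be [j] itself, which would create a loop. *)
Lemma card_nbrs_diff n (G : graph n) i j :
  (#|nbrs G i| <= #|[set v | [&& v \in nbrs G i, v \notin nbrs G j & v != j]]%SET|
     + #|nbrs G j| + 1)%N.
Proof.
rewrite -addnA -(cards1 j).
apply: (@leq_trans #|[set v | [&& v \in nbrs G i, v \notin nbrs G j & v != j]]%SET
                      :|: (nbrs G j :|: [set j])|%SET).
  apply: subset_leq_card; apply/fintype.subsetP => v vi.
  by rewrite !finset.in_setU !inE; move: vi; rewrite inE => ->;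
     case: (_ \in G); case: (v == j).
by rewrite (leq_trans (leq_card_setU _ _)) // leq_add2l leq_card_setU.
Qed.

Section Weights.
Variables (R : realType) (beta : R) (n m : nat).
Hypothesis beta0 : 0 <= beta.
Implicit Types (G : graph n) (A B : {set graph n}).

Local Notation Omega := (graphs_with_edges n m).

Definition weight A : R := \sum_(G in A) gibbs_weight beta G.

Lemma gibbs_weight_ge0 G : 0 <= gibbs_weight beta G.
Proof. exact: expR_ge0. Qed.

Lemma weight_ge0 A : 0 <= weight A.
Proof. by apply: sumr_ge0 => G _; exact: gibbs_weight_ge0. Qed.

Lemma weight_sub A B : A \subset B -> weight A <= weight B.
Proof.
move=> /fintype.subsetP AB; rewrite /weight [leLHS]big_mkcond [leRHS]big_mkcond.
apply: ler_sum => G _; have := AB G; case: (G \in A) => [->//|_].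
by case: ifP => // _; exact: gibbs_weight_ge0.
Qed.

Lemma weight_setU A B : weight (A :|: B)%SET <= weight A + weight B.
Proof.
rewrite /weight [leLHS]big_mkcond [X in _ <= X + _]big_mkcond.
rewrite [X in _ <= _ + X]big_mkcond -big_split; apply: ler_sum => G _.
rewrite finset.in_setU; have := gibbs_weight_ge0 G.
by case: (G \in A); case: (G \in B) => /= w0; rewrite ?addr0 ?add0r // lerDl.
Qed.

Lemma weight_bigcup (I : finType) (P : pred I) (F : I -> {set graph n}) :
  weight (\bigcup_(i | P i) F i)%SET <= \sum_(i | P i) weight (F i).
Proof.
apply: (@big_ind2 _ _ (fun A x => weight A <= x)) => //.
  by rewrite /weight big_set0.
by move=> A x B y Ax By; apply: le_trans (lerD Ax By); exact: weight_setU.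
Qed.

Lemma graphsP G : G \in Omega -> G \subset vertex_pairs n.
Proof. by rewrite inE => /andP[]. Qed.

Lemma toggle_graphs (D A : {set {set 'I_n}}) G :
  D \subset G -> [disjoint A & G] -> A \subset vertex_pairs n -> #|D| = #|A| ->
  G \in Omega -> toggle (D :|: A) G \in Omega.
Proof.
move=> DG dAG Apairs DA; rewrite !inE => /andP[/fintype.subsetP GP /eqP Gm].
apply/andP; split.
  apply/fintype.subsetP => e; rewrite inE; case: (boolP (e \in G)) => [/GP //|eG].
  rewrite inE => /orP[eD|/(fintype.subsetP Apairs)//].
  by rewrite (fintype.subsetP DG e eD) in eG.
have := sum_toggle (fun=> 1%N) DG dAG; rewrite !sum1_card DA => /eqP.
by rewrite eqn_add2r Gm.
Qed.

Definition move_edge (i j v : 'I_n) G : graph n :=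
  toggle ([set [set i; v]] :|: [set [set j; v]])%SET G.

Section MoveEdge.
Variables (i j v : 'I_n) (G : graph n).
Hypotheses (ij : i != j) (GOmega : G \in Omega).
Hypotheses (ivG : [set i; v]%SET \in G) (jvG : [set j; v]%SET \notin G).
Hypothesis vj : v != j.

Let disjG : [disjoint [set [set j; v]]%SET & G].
Proof. by rewrite disjoints1. Qed.

Let subG : ([set [set i; v]] \subset G)%SET.
Proof. by rewrite finset.sub1set. Qed.

Lemma move_edge_graphs : move_edge i j v G \in Omega.
Proof.
apply: toggle_graphs => //; last by rewrite !cards1.
by rewrite finset.sub1set inE cards2 (eq_sym j) vj.
Qed.

Let degree_move l :
  (degree (move_edge i j v G) l + (l \in [set i; v]%SET)
   = degree G l + (l \in [set j; v]%SET))%N.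
Proof. 
have := sum_toggle (fun e : {set 'I_n} => (l \in e : nat)) subG disjG.
by rewrite !big_set1 -!degree_sumE.
Qed.

Let iv : i != v. Proof. exact: edge_neq (graphsP GOmega) ivG. Qed.

Lemma degree_move_from : (degree (move_edge i j v G) i).+1 = degree G i.
Proof.
have := degree_move i.
by rewrite !set2E eqxx (negbTE ij) (negbTE iv) addn1 addn0.
Qed.

Lemma degree_move_to : degree (move_edge i j v G) j = (degree G j).+1.
Proof.
have := degree_move j.
by rewrite !set2E eqxx eq_sym (negbTE ij) eq_sym (negbTE vj) addn1 addn0.
Qed.

Lemma degree_move_other l : l != i -> l != j ->
  degree (move_edge i j v G) l = degree G l.
Proof.
move=> li lj; have := degree_move l.
by rewrite !set2E (negbTE li) (negbTE lj) => /addIn.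
Qed.

(** The sum of squares drops by [2 * (d_i - d_j - 1)], which the assumed gap makes at least
    [2 * y]. *)
Lemma gibbs_weight_move y : (degree G j + y + 1 <= degree G i)%N ->
  gibbs_weight beta G <=
    expR (- (2 * beta * y%:R)) * gibbs_weight beta (move_edge i j v G).
Proof.
move=> gap; rewrite /gibbs_weight -expRD ler_expR.
rewrite (bigD1 i) //= (bigD1 j) 1?eq_sym //=.
rewrite [X in _ <= _ + _ * X](bigD1 i) //= [X in _ <= _ + _ * (_ + X)](bigD1 j) 1?eq_sym //=.
have -> : \sum_(l < n | (l != i) && (l != j)) (degree (move_edge i j v G) l)%:R ^+ 2
    = \sum_(l < n | (l != i) && (l != j)) (degree G l)%:R ^+ 2 :> R.
  by apply: eq_bigr => l /andP[li lj]; rewrite degree_move_other.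
have {}gap : (degree G j)%:R + y%:R <= (degree (move_edge i j v G) i)%:R :> R.
  by rewrite -natrD ler_nat; move: gap; rewrite -degree_move_from; lia.
rewrite degree_move_to -degree_move_from -!natr1.
set S := \sum_(_ < n | _) _.
have := mulr_ge0 beta0 (_ : 0 <= (degree (move_edge i j v G) i)%:R
                               - ((degree G j)%:R + y%:R)).
by rewrite subr_ge0 => /(_ gap); nra.
Qed.

End MoveEdge.

Definition degree_gap (i j : 'I_n) (a b : nat) : {set graph n} :=
  [set G in Omega | (a <= degree G i)%N && (degree G j <= b)%N]%SET.

(** At least [a - b - 1 >= b + 1] edges can be moved from [i] to [j]. A move into a given graph is
    identified by a neighbour of [j] there, so at most [b + 1] lead back. The counts cancel and only
    the gain in weight remains. *)
Lemma degree_gap_step i j a b y : i != j -> (2 * b + 2 <= a)%N ->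
  (y + b + 1 <= a)%N ->
  weight (degree_gap i j a b) <=
    expR (- (2 * beta * y%:R)) * weight (degree_gap i j a.-1 b.+1).
Proof.
move=> ij ba ya.
pose valid G v := [&& v \in nbrs G i, v \notin nbrs G j & v != j].
have b0 : 0 < b.+1%:R :> R by rewrite ltr0n.
rewrite -(ler_pM2l b0) mulrA.
apply: (@switching R (graph n) 'I_n (move_edge i j) (@gibbs_weight R beta n) _ _ valid).
- by move=> v; exact: toggleK.
- exact: gibbs_weight_ge0.
- exact: expR_ge0.
- move=> G v; rewrite !inE => /and3P[GOm ai bj] /and3P[].
  rewrite !inE => iv jv vj.
  have GO : G \in Omega by rewrite inE.
  split; last by apply: gibbs_weight_move => //; lia.
  have := move_edge_graphs GO iv jv vj; rewrite !inE => ->.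
  have := degree_move_from ij GO iv jv.
  rewrite (degree_move_to ij iv jv vj); lia.
- move=> G; rewrite inE => /and3P[/graphsP GP ai bj].
  have := card_nbrs_diff G i j; rewrite -!degreeE // /valid; lia.
- move=> G; rewrite inE => /and3P[/graphsP GP ai bj].
  apply: leq_trans bj; rewrite degreeE //; apply: subset_leq_card.
  apply/fintype.subsetP => v; rewrite inE => /andP[_ /and3P[_ jv _]].
  rewrite inE in jv; rewrite inE.
  rewrite -[G](toggleK ([set [set i; v]] :|: [set [set j; v]])%SET).
  by apply: mem_toggle_added; rewrite ?disjoints1 ?finset.set11.
Qed.

Lemma degree_gap_weight i j y : i != j -> (4 <= y)%N ->
  weight (degree_gap i j (4 * y) y) <=
    expR (- (2 * beta * y%:R)) ^+ y./2 * weight Omega.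
Proof.
move=> ij y4.
(* After [t] moves the two thresholds are [4 * y - t] and [y + t]; for all steps up to [t = y / 2]
   the upper one stays more than twice the lower one. *)
have iter t : (2 * t <= y)%N -> weight (degree_gap i j (4 * y) y) <=
    expR (- (2 * beta * y%:R)) ^+ t * weight (degree_gap i j (4 * y - t) (y + t)).
  elim: t => [|t IH] ty; first by rewrite mul1r subn0 addn0.
  apply: (le_trans (IH _)); first lia.
  rewrite exprSr -[leRHS]mulrA; apply: ler_wpM2l; first by rewrite exprn_ge0 ?expR_ge0.
  by rewrite subnS addnS; apply: degree_gap_step => //; lia.
apply: (le_trans (iter y./2 _)); first lia.
rewrite ler_wpM2l ?exprn_ge0 ?expR_ge0 // weight_sub //.
by apply/fintype.subsetP => G; rewrite inE => /andP[].
Qed.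

Definition balanced y : {set graph n} :=
  [set G in Omega | [forall i, (y < degree G i < 64 * y)%N]]%SET.

(* Some vertex has degree at least the mean, hence at least 4y, and some vertex at most
   the mean, hence at most 16y; compare any other vertex with one of these. *)
Lemma unbalanced_weight y : (4 <= y)%N ->
  (4 * y * n <= 2 * m <= 16 * y * n)%N ->
  weight (Omega :\: balanced y)%SET <=
    2 * n%:R ^+ 2 * expR (- (2 * beta * y%:R)) ^+ y./2 * weight Omega.
Proof.
move=> y4 /andP[lom him].
pose F (p : 'I_n * 'I_n) :=
  (degree_gap p.1 p.2 (4 * y) y :|: degree_gap p.1 p.2 (4 * (16 * y)) (16 * y))%SET.
have cover : (Omega :\: balanced y \subset \bigcup_(p | p.1 != p.2) F p)%SET.
  apply/fintype.subsetP => G; rewrite finset.in_setD inE => /andP[+ GO].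
  rewrite GO /= negb_forall => /existsP[l]; rewrite negb_and -!leqNgt => bad.
  have degs : (\sum_i degree G i = 2 * m)%N.
    by rewrite sum_degree ?graphsP //; move: GO; rewrite inE => /andP[_ /eqP->].
  case/orP: bad => bad.
    have [i iP] : exists i, (4 * y <= degree G i)%N.
      apply/existsP; apply: contraT; rewrite negb_exists => /forallP small.
      have : (\sum_i (degree G i).+1 <= \sum_(i < n) 4 * y)%N.
        by apply: leq_sum => i _; have := small i; lia.
      under eq_bigr do rewrite -addn1.
      rewrite big_split /= degs !sum_nat_const card_ord.
      have := ltn_ord l; lia.
    apply/bigcupP; exists (i, l) => /=.
      by apply/eqP => il; move: iP; rewrite il; lia.
    by rewrite !inE /= bad iP andbT; move: GO; rewrite inE => ->.
  have [j jP] : exists j, (degree G j <= 16 * y)%N.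
    apply/existsP; apply: contraT; rewrite negb_exists => /forallP large.
    have : (\sum_(i < n) (16 * y).+1 <= \sum_i (degree G i))%N.
      by apply: leq_sum => i _; have := large i; lia.
    rewrite degs sum_nat_const card_ord.
    have := ltn_ord l; nia.
  apply/bigcupP; exists (l, j) => /=.
    by apply/eqP => il; move: jP; rewrite -il; lia.
  rewrite finset.in_setU; apply/orP; right; rewrite inE GO jP andbT /=; lia.
apply: (le_trans (weight_sub cover)); apply: (le_trans (weight_bigcup _ _)).
set rho := expR _ ^+ _.
have bound p : p.1 != p.2 -> weight (F p) <= 2 * rho * weight Omega.
  move=> p12; apply: (le_trans (weight_setU _ _)).
  rewrite -mulrA mulr_natl mulr2n; apply: lerD; first exact: degree_gap_weight.
  (* The decay improves as the scale grows, so the gap at scale [16 * y] obeys the bound for scale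
     [y]. *)
  apply: le_trans (degree_gap_weight p12 _) _; first lia.
  rewrite ler_wpM2r ?weight_ge0 // /rho -!expRM_natl ler_expR.
  rewrite [leLHS]mulrN [leRHS]mulrN lerN2.
  have h1 : (y%:R <= (16 * y)%:R :> R) by rewrite ler_nat; lia.
  have h2 : (y./2%:R <= (16 * y)./2%:R :> R) by rewrite ler_nat; lia.
  by apply: ler_pM; rewrite ?mulr_ge0 //; apply: ler_wpM2l; rewrite ?mulr_ge0.
apply: (le_trans (ler_sum _ bound)).
apply: (@le_trans _ _ (\sum_(p : 'I_n * 'I_n) 2 * rho * weight Omega)).
  rewrite big_mkcond; apply: ler_sum => p _; case: ifP => // _.
  by rewrite !mulr_ge0 ?weight_ge0 ?exprn_ge0 ?expR_ge0.
rewrite sumr_const card_prod card_ord -[_ *+ (n * n)]mulr_natl natrM.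
by rewrite le_eqVlt; apply/orP; left; apply/eqP; ring.
Qed.

End Weights.


(** * Degree-preserving switches across a cut *)

Section EdgeSwap.
Variable n : nat.
Implicit Types (G : graph n) (U : {set 'I_n}) (q : ('I_n * 'I_n) * ('I_n * 'I_n)).

(** With [q = ((u, v), (x, w))], the edges uv and xw are exchanged for ux and vw. The pairs are
    ordered, so two given edges admit several switches. *)
Definition swap q G : graph n :=
  toggle ([set [set q.1.1; q.1.2]; [set q.2.1; q.2.2]] :|:
          [set [set q.1.1; q.2.1]; [set q.1.2; q.2.2]])%SET G.

Definition swappable U G q : bool :=
  [&& q.1 \in inner G U, q.2 \in inner G (~: U)%SET,
      [set q.1.1; q.2.1]%SET \notin G & [set q.1.2; q.2.2]%SET \notin G].

Section OneSwap.
Variables (U : {set 'I_n}) (G : graph n) (u v x w : 'I_n).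
Hypotheses (GP : G \subset vertex_pairs n) (ok : swappable U G ((u, v), (x, w))).

Let facts : [/\ u \in U, v \in U, x \notin U & w \notin U].
Proof. by move: ok; rewrite /swappable !inE /= => /and4P[/and3P[-> -> _] /and3P[-> -> _]]. Qed.

Let edges : [/\ [set u; v]%SET \in G, [set x; w]%SET \in G,
  [set u; x]%SET \notin G & [set v; w]%SET \notin G].
Proof. by move: ok; rewrite /swappable !inE /= => /and4P[/and3P[_ _ ->] /and3P[_ _ ->] -> ->]. Qed.

Let cross_neq a b : a \in U -> b \notin U -> a != b.
Proof. by move=> aU bU; apply: contraNneq bU => <-. Qed.

Let subG : ([set [set u; v]; [set x; w]] \subset G)%SET.
Proof. by have [h1 h2 _ _] := edges; rewrite finset.subUset !finset.sub1set h1 h2. Qed.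

Lemma swappable_disjoint : [disjoint [set [set u; x]; [set v; w]]%SET & G].
Proof.
have [_ _ h1 h2] := edges; rewrite disjoint_subset.
by apply/fintype.subsetP => e; rewrite !inE => /orP[]/eqP->.
Qed.

Let uv : u != v. Proof. by have [h _ _ _] := edges; exact: edge_neq GP h. Qed.

Let removed_neq : [set u; v]%SET != [set x; w]%SET.
Proof.
have [uU _ xU wU] := facts; apply/eqP => e.
have : u \in [set x; w]%SET by rewrite -e set2E eqxx.
by rewrite set2E !(negbTE (cross_neq _ _)).
Qed.

Let added_neq : [set u; x]%SET != [set v; w]%SET.
Proof.
have [uU _ xU wU] := facts; apply/eqP => e.
have : u \in [set v; w]%SET by rewrite -e set2E eqxx.
by rewrite set2E (negbTE uv) (negbTE (cross_neq _ _)).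
Qed.

Let sum_swap (F : {set 'I_n} -> nat) :
  (\sum_(e in swap ((u, v), (x, w)) G) F e + (F [set u; v]%SET + F [set x; w]%SET)
   = \sum_(e in G) F e + (F [set u; x]%SET + F [set v; w]%SET))%N.
Proof.
have := sum_toggle F subG swappable_disjoint.
by rewrite !big_setU1 ?inE //= !big_set1.
Qed.

Lemma degree_swap l : degree (swap ((u, v), (x, w)) G) l = degree G l.
Proof.
have := sum_swap (fun e => (l \in e : nat)).
rewrite -!degree_sumE; have [uU vU xU wU] := facts.
have ux := cross_neq uU xU; have uw := cross_neq uU wU.
have vx := cross_neq vU xU; have vw := cross_neq vU wU.
have [h1 h2 _ _] := edges; have xw := edge_neq GP h2.
rewrite !set2E; set d := degree G l; set d' := degree _ l; move: (d) (d') => {d d'} d d'.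
case: (eqVneq l u) => [->|_].
  by rewrite (negbTE uv) (negbTE ux) (negbTE uw) => /addIn.
case: (eqVneq l v) => [->|_].
  by rewrite (negbTE vx) (negbTE vw) => /addIn.
by case: (eqVneq l x) => [->|_]; rewrite ?(negbTE xw); case: (l == w) => /= /addIn.
Qed.

Lemma cut_size_swap : cut_size (swap ((u, v), (x, w)) G) U = (cut_size G U).+2.
Proof.
have := sum_swap (fun e => cutting U e : nat).
rewrite -!cut_size_sumE !cuttingE; have [-> -> /negbTE-> /negbTE->] := facts.
by move=> e; rewrite -[LHS]addn0 -[RHS]addn2; exact: e.
Qed.

Lemma swap_graphs m : G \in graphs_with_edges n m ->
  swap ((u, v), (x, w)) G \in graphs_with_edges n m.
Proof.
have [uU vU xU wU] := facts.
apply: (toggle_graphs subG swappable_disjoint) => //=; last first.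
  by rewrite !cards2 removed_neq added_neq.
by rewrite finset.subUset !finset.sub1set !inE !cards2 !cross_neq.
Qed.

End OneSwap.

(* A blocked switch is a walk v - u - x - w whose middle edge crosses the cut. *)
Lemma card_blocked_swaps U G D : (forall i, #|nbrs G i| <= D)%N ->
  (#|[set q | [&& q.1 \in inner G U, q.2 \in inner G (~: U)%SET
                & [set q.1.1; q.2.1]%SET \in G]]%SET| <= cut_size G U * (D * D))%N.
Proof.
move=> degD; rewrite cut_sizeE.
apply: (@leq_card_fibres _ _ (fun q => (q.1.1, q.2.1))) => [q|[u x] _].
  by rewrite !inE => /and3P[/and3P[-> _ _] /and3P[-> _ _] ->].
rewrite -(@card_in_imset _ _ (fun q => (q.1.2, q.2.2))); last first.
  move=> [[a b] [c d]] [[a' b'] [c' d']]; rewrite !inE /=.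
  by move=> /andP[_ /eqP[-> ->]] /andP[_ /eqP[-> ->]] [-> ->].
apply: (@leq_trans #|finset.setX (nbrs G u) (nbrs G x)|); last first.
  by rewrite cardsX leq_mul.
apply: subset_leq_card; apply/fintype.subsetP => _ /imsetP[[[a b] [c d]] + ->].
by rewrite !inE /= => /andP[/and3P[/and3P[_ _ ab] /and3P[_ _ cd] _] /eqP[<- <-]];
   rewrite ab cd.
Qed.

(** From all pairs of an inner and an outer edge, discard those for which ux or vw is already
    present. Reversing both orientations maps the second kind into the first, hence the factor 2. *)
Lemma card_swappable U G D : (forall i, #|nbrs G i| <= D)%N ->
  (#|inner G U| * #|inner G (~: U)%SET| <=
   #|[set q | swappable U G q]%SET| + 2 * (cut_size G U * (D * D)))%N.
Proof.
move=> degD; rewrite -cardsX.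
set B1 := [set q | [&& q.1 \in inner G U, q.2 \in inner G (~: U)%SET
                     & [set q.1.1; q.2.1]%SET \in G]]%SET.
set B2 := [set q | [&& q.1 \in inner G U, q.2 \in inner G (~: U)%SET
                     & [set q.1.2; q.2.2]%SET \in G]]%SET.
have B1le : (#|B1| <= cut_size G U * (D * D))%N by exact: card_blocked_swaps.
have B2le : (#|B2| <= #|B1|)%N.
  pose flip q := ((q.1.2, q.1.1), (q.2.2, q.2.1)).
  have flipI : injective flip by move=> [[a b] [c d]] [[a' b'] [c' d']] [-> -> -> ->].
  rewrite -(card_imset B2 flipI); apply: subset_leq_card.
  apply/fintype.subsetP => _ /imsetP[[[a b] [c d]] + ->].
  rewrite !inE /= => /and3P[/and3P[-> -> ab] /and3P[-> -> cd] ->].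
  by rewrite finset.setUC ab finset.setUC cd.
apply: (@leq_trans #|[set q | swappable U G q] :|: (B1 :|: B2)|%SET).
  apply: subset_leq_card; apply/fintype.subsetP => -[p r]; rewrite finset.in_setX.
  move=> /andP[pU rU]; rewrite !finset.in_setU.
  rewrite [_ \in B1]inE [_ \in B2]inE [_ \in [set q | _]%SET]inE /swappable /= pU rU /=.
  by do 2!case: (_ \in _).
apply: (leq_trans (leq_card_setU _ _)); rewrite leq_add2l.
by rewrite (leq_trans (leq_card_setU _ _)) // mul2n -addnn leq_add // (leq_trans B2le).
Qed.

(** A switch arriving at [G] is determined by the two edges ux and vw that it added, and both cross
    the cut in [G]. *)
Lemma card_unswap U (P : pred (graph n)) G :
  (#|[set q | P (swap q G) && swappable U (swap q G) q]%SET|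
     <= cut_size G U * cut_size G U)%N.
Proof.
rewrite cut_sizeE -cardsX.
pose h q := ((q.1.1, q.2.1), (q.1.2, q.2.2)).
have hI : injective h by move=> [[a b] [c d]] [[a' b'] [c' d']] [-> -> -> ->].
rewrite -(card_imset _ hI); apply: subset_leq_card.
apply/fintype.subsetP => _ /imsetP[[[u v] [x w]] + ->].
rewrite inE => /andP[_ ok].
move: (ok) => /and4P[]; rewrite inE [_ \in inner _ (~: U)%SET]inE /=.
move=> /and3P[uU vU uv] /and3P[]; rewrite !finset.in_setC => xU wU xw ux vw.
have added e : e \in [set [set u; x]; [set v; w]]%SET -> e \in G.
  move/(mem_toggle_added [set [set u; v]; [set x; w]]%SET (swappable_disjoint ok)).
  by rewrite /swap toggleK.
by rewrite finset.in_setX !inE /= uU vU xU wU !added // !inE eqxx ?orbT.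
Qed.


End EdgeSwap.


(** * Summation over vertex sets *)

(* The left-hand side is one term of the expansion of (1 + k/n)^n. *)
Lemma bin_le_expR (R : realType) (n k : nat) : (k <= n)%N ->
  ('C(n, k))%:R * (k%:R / n%:R) ^+ k <= expR k%:R :> R.
Proof.
move=> kn; case: (posnP n) => [n0|n0].
  by move: kn; rewrite n0 leqn0 => /eqP ->; rewrite expr0 mulr1 expR0 bin0.
have x0 : 0 <= k%:R / n%:R :> R by rewrite divr_ge0.
apply: (@le_trans _ _ ((1 + k%:R / n%:R) ^+ n)).
  rewrite exprDn (bigD1 (Ordinal (kn : (k < n.+1)%N))) //= expr1n mul1r mulr_natl.
  rewrite lerDl; apply: sumr_ge0 => i _.
  by rewrite mulrn_wge0 // mulr_ge0 // exprn_ge0.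
have -> : expR (k%:R : R) = expR (k%:R / n%:R) ^+ n.
  by rewrite -expRM_natl mulrC divfK // pnatr_eq0 -lt0n.
by rewrite lerXn2r ?nnegrE ?expR_ge0 ?addr_ge0 // expR_ge1Dx.
Qed.

Lemma sum_geometric_le (R : realFieldType) (x : R) (n : nat) :
  0 <= x -> x <= 2^-1 -> \sum_(1 <= k < n.+1) x ^+ k <= 2 * x.
Proof.
move=> x0 x2.
(* Keeping the remainder term makes the bound inductive. *)
suff : \sum_(1 <= k < n.+1) x ^+ k <= 2 * x - 2 * x ^+ n.+1.
  by move=> /le_trans; apply; rewrite lerBlDr lerDl mulr_ge0 ?exprn_ge0.
elim: n => [|n IH]; first by rewrite big_geq // expr1 subrr.
rewrite big_nat_recr //= [x ^+ n.+2]exprSr.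
have : x ^+ n.+1 * x <= x ^+ n.+1 * 2^-1 by rewrite ler_wpM2l // exprn_ge0.
move: IH; move: (x ^+ n.+1) => y; lra.
Qed.

(** Group the sets by size [k]. Of the [T.+1] powers of [(k/n)^k], one turns the binomial
    coefficient into at most [e^k]; the other [T] give at most [2^(-kT)] since [k <= n/2]. A
    geometric series is left. *)
Lemma sum_subsets_le (R : realType) (n T : nat) : expR 1 * 2^-1 ^+ T <= 2^-1 :> R ->
  \sum_(U : {set 'I_n} | (0 < #|U|)%N && (2 * #|U| <= n)%N)
     (#|U|%:R / n%:R) ^+ (#|U| * T.+1) <= 2 * (expR 1 * 2^-1 ^+ T) :> R.
Proof.
set x := expR 1 * _ => x2.
have x0 : 0 <= x by rewrite mulr_ge0 ?expR_ge0 ?exprn_ge0.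
apply: le_trans (sum_geometric_le n x0 x2).
have cardU (U : {set 'I_n}) : (#|U| < n.+1)%N by rewrite ltnS -[n in (_ <= n)%N]card_ord max_card.
rewrite (partition_big (fun U => Ordinal (cardU U)) (fun k : 'I_n.+1 => (0 < k)%N)) /=; last first.
  by move=> U /andP[].
rewrite big_geq_mkord; apply: ler_sum => k k0.
case: (leqP (2 * k) n) => kn; last first.
  rewrite big_pred0 ?exprn_ge0 // => U; apply/negbTE/negP => /andP[/andP[_ Un] /eqP Uk].
  by move: kn; rewrite -Uk /= ltnNge Un.
apply: (@le_trans _ _ (\sum_(U in [set A : {set 'I_n} | #|A| == k]%SET)
    (k%:R / n%:R) ^+ (k * T.+1))).
  rewrite [leLHS]big_mkcond [leRHS]big_mkcond; apply: ler_sum => U _; rewrite inE.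
  case: ifP => [/andP[_ /eqP <-] /=|_]; first by rewrite eqxx.
  by case: ifP => // _; rewrite exprn_ge0 // divr_ge0.
rewrite sumr_const card_draws card_ord -[leLHS]mulr_natl.
have kn' : (k <= n)%N by lia.
rewrite mulnS exprD mulrA.
have -> : x ^+ k = expR k%:R * (2^-1 ^+ T) ^+ k.
  by rewrite exprMn -expRM_natl mulr1.
apply: ler_pM; rewrite ?mulr_ge0 ?exprn_ge0 ?divr_ge0 //; first exact: bin_le_expR.
rewrite mulnC exprM lerXn2r ?nnegrE ?exprn_ge0 ?divr_ge0 //.
rewrite lerXn2r ?nnegrE ?divr_ge0 // ler_pdivrMr ?ltr0n; last by lia.
by rewrite mulrC ler_pdivlMr // -natrM ler_nat mulnC.
Qed.

(** * Small cuts in balanced graphs *)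

Section LowCut.
Variables (R : realType) (beta : R) (n m z : nat).
Implicit Types (G : graph n) (U : {set 'I_n}).

Definition low_cut U (t : nat) : {set graph n} :=
  [set G in balanced n m (8 * z) | (cut_size G U <= t)%N]%SET.

Lemma low_cut_step U t : (0 < #|U|)%N -> (2 * #|U| <= n)%N -> (0 < z)%N ->
  (4 * 512 * 512 * z <= n)%N -> (t.+2 <= 2 * #|U| * z)%N ->
  n%:R * weight beta (low_cut U t) <= #|U|%:R * weight beta (low_cut U t.+2).
Proof.
set k := #|U|; move=> k0 kn z0 zn tk.
(* Scaling factor for the counts: at most [(2kz)^2 = 4kzz * k] switches lead back and at least
   [4kzz * n] lead forward. *)
have c0 : 0 < (4 * k * z * z)%:R :> R by rewrite ltr0n !muln_gt0 k0 z0.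
rewrite -(ler_pM2l c0) !mulrA -!natrM.
(* A switch preserves all degrees and hence the weight, so [rho = 1]. *)
rewrite -[X in _ <= X * _]mulr1.
apply: (@switching R (graph n) _ (@swap n) (@gibbs_weight R beta n) _ _
  (fun G q => swappable U G q)) => //.
- by move=> q; exact: toggleK.
- by move=> G; exact: expR_ge0.
- move=> G [[u v] [x w]]; rewrite !inE => /andP[/andP[GO /forallP bal] cut] ok.
  have GO' : G \in graphs_with_edges n m by rewrite inE.
  have GP := graphsP GO'.
  split.
    have := swap_graphs GP ok GO'; rewrite !inE => -> /=.
    rewrite (cut_size_swap GP ok) !ltnS cut andbT.
    by apply/forallP => i; rewrite (degree_swap GP ok) bal.
  rewrite mul1r /gibbs_weight le_eqVlt; apply/orP; left; apply/eqP.
  by congr (expR (_ * _)); apply: eq_bigr => i _; rewrite (degree_swap GP ok).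
- move=> G; rewrite !inE => /andP[/andP[GO /forallP bal] cut].
  have GP : G \subset vertex_pairs n by case/andP: GO.
  have degD i : (#|nbrs G i| <= 512 * z)%N.
    by rewrite -degreeE //; have := bal i; lia.
  have := card_swappable U degD.
  have low (V : {set 'I_n}) : (#|V| * (8 * z) <= #|inner G V| + cut_size G V)%N.
    rewrite -sum_degree_cut // -sum_nat_const; apply: leq_sum => i _.
    by have := bal i; lia.
  have := low U; have := low (~: U)%SET; rewrite cut_sizeC.
  have := cardsC U; rewrite card_ord -/k.
  move: #|~: U|%SET #|inner G U| #|inner G (~: U)%SET| => k' a b kk' b_low a_low.
  move: #|[set q | swappable U G q]%SET| => v.
  move: (cut_size G U) cut a_low b_low => s cut a_low b_low.
  (* The degrees in [U] sum to at least [8kz], those outside to at least [4nz]; the cut takes away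
     at most [2kz <= nz] from each. *)
  have a_ge : (6 * (k * z) <= a)%N by nia.
  have b_ge : (3 * (n * z) <= b)%N by nia.
  have := leq_mul a_ge b_ge.
  (* Here [n] must be large compared with [z]: the blocked switches number at most [kz * nz],
     against at least [18 * kz * nz] pairs. *)
  have : (s * (512 * z * (512 * z)) * 2 <= k * z * (n * z))%N.
    have : (2 * s * (512 * z * (512 * z)) <= 2 * (2 * k * z) * (512 * z * (512 * z)))%N.
      by rewrite leq_mul2r leq_mul2l; apply/orP; right; lia.
    have : (k * z * z * (4 * 512 * 512 * z) <= k * z * z * n)%N by rewrite leq_mul2l zn orbT.
    lia.
  nia.
- move=> G; rewrite !inE => /andP[_ cut].
  apply: (leq_trans (card_unswap U (fun G => G \in low_cut U t) G)).
  by apply: (@leq_trans ((2 * k * z) * (2 * k * z))%N); [apply: leq_mul; lia|lia].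
Qed.

Lemma low_cut_weight U : (0 < #|U|)%N -> (2 * #|U| <= n)%N -> (0 < z)%N ->
  (4 * 512 * 512 * z <= n)%N ->
  weight beta (low_cut U (#|U| * z)) <=
    (#|U|%:R / n%:R) ^+ (#|U| * z./2) * weight beta (graphs_with_edges n m).
Proof.
move=> U0 Un z0 zn.
have n0 : 0 < n%:R :> R by rewrite ltr0n; lia.
have r0 : 0 <= #|U|%:R / n%:R :> R by rewrite divr_ge0.
(* Each switch raises the cut by 2, so starting from [kz], with [k] the size of [U], the threshold
   stays below [2kz] for [kz/2] rounds. *)
have iter s : (2 * s <= #|U| * z)%N -> weight beta (low_cut U (#|U| * z)) <=
    (#|U|%:R / n%:R) ^+ s * weight beta (low_cut U (#|U| * z + 2 * s)).
  elim: s => [|s IH] sz; first by rewrite mul1r addn0.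
  apply: (le_trans (IH _)); first lia.
  rewrite exprSr -[leRHS]mulrA; apply: ler_wpM2l; first by rewrite exprn_ge0.
  rewrite mulrAC ler_pdivlMr // mulrC mulnS addnCA addnA.
  by apply: low_cut_step => //; lia.
apply: (le_trans (iter (#|U| * z./2)%N _)); first nia.
rewrite ler_wpM2l ?exprn_ge0 // weight_sub //.
by apply/fintype.subsetP => G; rewrite !inE => /andP[/andP[->]].
Qed.

End LowCut.


(** * Probability bounds for fixed [n] *)

(** A graph outside [P] is either unbalanced at scale [8 * z] or balanced with a low cut for some
    [U]; the two error terms bound these cases. *)
Lemma mu_ge (R : realType) (beta c : R) (n z : nat) (P : {pred graph n}) :
  let m := num_edges c n in let rho := expR 1 * 2^-1 ^+ z./2.-1 in
  0 <= beta -> (2 <= z)%N -> (m <= 'C(n, 2))%N ->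
  (4 * (8 * z) * n <= 2 * m <= 16 * (8 * z) * n)%N ->
  (4 * 512 * 512 * z <= n)%N -> rho <= 2^-1 ->
  (forall G, G \in balanced n m (8 * z) ->
     (forall U : {set 'I_n}, (0 < #|U|)%N -> (2 * #|U| <= n)%N ->
        (#|U| * z < cut_size G U)%N) -> G \in P) ->
  1 - (2 * n%:R ^+ 2 * expR (- (2 * beta * (8 * z)%:R)) ^+ (8 * z)./2 + 2 * rho)
    <= mu beta c P.
Proof.
move=> m rho beta0 z2 /(partition_function_gt0 beta) Z0 mz zn rho2 good.
rewrite /mu ler_pdivlMr // mulrBl mul1r lerBlDr.
set Omega := graphs_with_edges n m.
have -> : partition_function beta c n = weight beta Omega by [].
have -> : \sum_(G in graphs_with_edges n (num_edges c n) | G \in P) gibbs_weight beta G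
    = weight beta [set G in Omega | G \in P]%SET.
  by apply: eq_bigl => G; rewrite inE.
pose small (U : {set 'I_n}) := (0 < #|U|)%N && (2 * #|U| <= n)%N.
have cover : (Omega \subset [set G in Omega | G \in P] :|:
    ((Omega :\: balanced n m (8 * z)) :|:
     \bigcup_(U | small U) low_cut m z U (#|U| * z)))%SET.
  apply/fintype.subsetP => G GO; rewrite !finset.in_setU finset.in_setD GO andbT.
  rewrite orbA -implyNb; apply/implyP; rewrite negb_or negbK inE GO /= => /andP[GP bal].
  apply/bigcupP; apply: contrapT => nolow; move/negP: GP; apply.
  apply: good => // U U0 Un; rewrite ltnNge; apply/negP => cut; apply: nolow.
  by exists U; rewrite /small ?U0 // inE bal.
apply: (le_trans (weight_sub _ cover)); apply: (le_trans (weight_setU _ _ _)).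
rewrite lerD2l; apply: (le_trans (weight_setU _ _ _)); rewrite mulrDl.
apply: lerD; first by apply: unbalanced_weight => //; lia.
apply: (le_trans (weight_bigcup _ _ _)).
apply: (@le_trans _ _ (\sum_(U | small U)
    (#|U|%:R / n%:R) ^+ (#|U| * z./2) * weight beta Omega)).
  by apply: ler_sum => U /andP[U0 Un]; apply: low_cut_weight => //; lia.
rewrite -mulr_suml ler_wpM2r ?weight_ge0 //.
(* One power is set aside for the binomial coefficient; [z >= 2] makes it available. *)
have -> : z./2 = (z./2.-1).+1 by lia.
exact: sum_subsets_le.
Qed.

Lemma mu_le1 (R : realType) (beta c : R) (n : nat) (P : {pred graph n}) :
  (num_edges c n <= 'C(n, 2))%N -> mu beta c P <= 1.
Proof.
move=> /(partition_function_gt0 beta) Z0.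
rewrite /mu ler_pdivrMr // mul1r /partition_function big_mkcondr /=.
by apply: ler_sum => G _; case: ifP => // _; exact: expR_ge0.
Qed.

(** * Numerical estimates and choice of the scale [z] *)

Lemma expRN_le_inv (R : realType) (x : R) : 0 < x -> expR (- x) <= x^-1.
Proof.
move=> x0; rewrite expRN lef_pV2 ?posrE ?expR_gt0 //.
by apply: le_trans (expR_ge1Dx x); rewrite lerDr.
Qed.

Lemma sqr_div4_le_expR (R : realType) (x : R) : 0 <= x -> x ^+ 2 / 4 <= expR x.
Proof.
move=> x0; have -> : expR x = expR (x / 2) ^+ 2.
  by rewrite -expRM_natl mulrC divfK // pnatr_eq0.
have -> : x ^+ 2 / 4 = (x / 2) ^+ 2 by field.
rewrite lerXn2r ?nnegrE ?expR_ge0 ?divr_ge0 //.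
by apply: le_trans (expR_ge1Dx _); rewrite lerDr.
Qed.

(** With [t = z./2.-1] one has [z <= 2t + 3 <= 3(t + 1) <= 3 * 2^t]. *)
Lemma half_pow_le (R : realType) (z : nat) : (2 <= z)%N ->
  2^-1 ^+ z./2.-1 <= 3 / z%:R :> R.
Proof.
move=> z2; rewrite exprVn -[3 / _]invrK lef_pV2 ?posrE ?exprn_gt0 ?invr_gt0 ?divr_gt0 ?ltr0n //; last by lia.
rewrite invf_div ler_pdivrMr // -natrX -natrM ler_nat.
have := ltn_expl z./2.-1 (isT : (1 < 2)%N); lia.
Qed.

Local Open Scope classical_set_scope.
Local Open Scope ring_scope.

Lemma near_ln_ge (R : realType) (K : R) : \forall n \near \oo, K <= ln (n%:R : R).
Proof.
near=> n.
have le_n : expR K <= n%:R by near: n; exact: nbhs_infty_ger.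
rewrite -[K]expRK ler_ln ?posrE ?expR_gt0 //.
exact: lt_le_trans (expR_gt0 K) le_n.
Unshelve. all: by end_near. Qed.

Lemma num_edges_itv (R : realType) (c : R) (n : nat) : 0 <= c -> (0 < n)%N ->
  2 * (num_edges c n)%:R <= c * ln n%:R * n%:R < 2 * (num_edges c n)%:R + 2.
Proof.
move=> c0 n0.
have l0 : 0 <= ln n%:R :> R by rewrite ln_ge0 // ler1n.
have x0 : 0 <= 2^-1 * c * n%:R * ln n%:R by rewrite !mulr_ge0.
have /andP[] := truncn_itv x0; rewrite -/(num_edges c n) -(natr1 (num_edges c n)).
have -> : c * ln n%:R * n%:R = 2 * (2^-1 * c * n%:R * ln n%:R) by field.
by move: (_ * ln _) => x lo hi; apply/andP; split; lra.
Qed.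

Lemma num_edges_le_bin (R : realType) (c : R) (n : nat) : 0 <= c -> (0 < n)%N ->
  c * ln n%:R <= n%:R - 1 -> (num_edges c n <= 'C(n, 2))%N.
Proof.
move=> c0 n0 cn; have /andP[m_le _] := num_edges_itv c0 n0.
rewrite bin2 -leq_double.
suff : (2 * num_edges c n <= n * n.-1)%N.
  by move: (num_edges c n) (n * n.-1)%N => a b; clear; lia.
rewrite -(ler_nat R) !natrM; apply: (le_trans m_le).
rewrite mulrC; apply: ler_wpM2l => //; apply: (le_trans cn).
by rewrite -subn1 natrB.
Qed.

(** The condition of [unbalanced_weight] for [y = 8 * z]. The slack between 64 and [4 * 8 = 32]
    absorbs the rounding in [num_edges]. *)
Lemma num_edges_window (R : realType) (c : R) (n z : nat) : 0 <= c -> (0 < n)%N ->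
  (0 < z)%N -> 64 * z%:R <= c * ln n%:R -> c * ln n%:R <= 128 * z%:R ->
  (4 * (8 * z) * n <= 2 * num_edges c n <= 16 * (8 * z) * n)%N.
Proof.
move=> c0 n0 z0 lo hi; have /andP[m_lo m_hi] := num_edges_itv c0 n0.
have n0' : 0 <= n%:R :> R by [].
have zn1 : 1 <= z%:R * n%:R :> R by rewrite -natrM ler1n muln_gt0 z0.
have lo' := ler_wpM2r n0' lo; have hi' := ler_wpM2r n0' hi.
by apply/andP; split; rewrite -(ler_nat R) !natrM; lra.
Qed.

(** The exponent is [2 ln n - 64 beta z^2]. As [2 ln n <= (256/c) z], the assumption on [beta * z]
    makes it at most [-z], and [exp(-z) <= 1/z]. *)
Lemma unbalanced_term_le (R : realType) (beta c : R) (n z : nat) :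
  0 < c -> (0 < n)%N -> (0 < z)%N -> c * ln n%:R <= 128 * z%:R ->
  1 + 256 / c <= 64 * beta * z%:R ->
  n%:R ^+ 2 * expR (- (2 * beta * (8 * z)%:R)) ^+ (8 * z)./2 <= z%:R^-1 :> R.
Proof.
move=> c0 n0 z0 hi big.
have -> : (8 * z)./2 = (4 * z)%N by clear; lia.
rewrite -[n%:R in leLHS]lnK ?posrE ?ltr0n // -!expRM_natl -expRD.
have zR : 0 < z%:R :> R by rewrite ltr0n.
apply: le_trans (expRN_le_inv zR); rewrite ler_expR.
have ln_le : ln n%:R <= 128 / c * z%:R by rewrite mulrAC ler_pdivlMr // mulrC.
have := ler_wpM2r (ltW zR) big; rewrite !natrM.
move: ln_le; move: (ln _) (z%:R) (c^-1) => l y d; lra.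
Qed.

Lemma cut_size_large (R : realType) (c : R) (n z : nat) (G : graph n) :
  c * ln n%:R <= 128 * z%:R ->
  (forall U : {set 'I_n}, (0 < #|U|)%N -> (2 * #|U| <= n)%N ->
     (#|U| * z < cut_size G U)%N) ->
  forall U : {set 'I_n}, #|U|%:R <= n%:R / 2 :> R ->
    (1 - (1 - 128^-1)) * c * #|U|%:R * ln n%:R <= (cut_size G U)%:R :> R.
Proof.
move=> hi cuts U; rewrite ler_pdivlMr // -natrM ler_nat mulnC => Un.
case: (posnP #|U|) => [->|U0]; first by rewrite mulr0 mul0r.
apply: (@le_trans _ _ (#|U| * z)%:R); last by rewrite ler_nat ltnW ?cuts.
have := ler_wpM2l (ler0n R #|U|) hi; rewrite natrM; lra.
Qed.

(** The three summands assumed below [ln n] give in turn [z >= Z], [c ln n <= n - 1] and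
    [N * z <= n]; the last two use [n >= (ln n)^2 / 4]. *)
Lemma exists_scale (R : realType) (c Z : R) (N n : nat) : 0 < c -> 2 <= Z ->
  64 / c * (Z + 1) + 8 * (c + 1) + 4 * N%:R * c <= ln (n%:R : R) ->
  exists z : nat, [/\ Z <= z%:R, 64 * z%:R <= c * ln n%:R, c * ln n%:R <= 128 * z%:R,
    (0 < n)%N & c * ln n%:R <= n%:R - 1 /\ (N * z <= n)%N].
Proof.
move=> c0 Z2.
(* Since [ln] is 0 at nonpositive arguments, a positive logarithm excludes [n = 0]. *)
have nE : 0 < ln (n%:R : R) -> n%:R = expR (ln n%:R) :> R.
  by move=> l0; rewrite lnK // posrE ltNge; apply/negP => /ln0 l0'; rewrite l0' ltxx in l0.
move: (ln _) nE => l nE big.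
have Nc0 : 0 <= N%:R * c by rewrite mulr_ge0 // ltW.
have Zc0 : 0 < 64 / c * (Z + 1) by rewrite mulr_gt0 ?divr_gt0 //; lra.
have l8 : 8 * (c + 1) <= l by lra.
have lN : 4 * (N%:R * c) <= l by lra.
have l0 : 0 < l by lra.
have lZ : 64 * (Z + 1) <= c * l.
  have : 64 / c * (Z + 1) <= l by lra.
  by rewrite mulrAC ler_pdivrMr // mulrC [l * c]mulrC.
have l2 : l ^+ 2 / 4 <= n%:R by rewrite nE // sqr_div4_le_expR // ltW.
have n0 : 0 < n%:R :> R by rewrite nE // expR_gt0.
have cl0 : 0 <= c * l / 64 by rewrite divr_ge0 // mulr_ge0 // ltW.
(* The scale is the integer part of [c ln n / 64]. *)
have /andP[] := truncn_itv cl0; set z := Num.truncn _; rewrite -(natr1 z).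
move: z => z zlo zhi; exists z.
have zlo' : 64 * z%:R <= c * l by lra.
have ll := ler_wpM2l (ltW l0) l8.
split; [lra|exact: zlo'|lra|by rewrite ltr0n in n0|split].
  move: ll l2; rewrite expr2 mulrDr mulrDr; lra.
rewrite -(ler_nat R) natrM.
have h1 := ler_wpM2l (ler0n R N) zlo'.
have h2 := ler_wpM2r (ltW l0) lN.
have h3 : 0 <= N%:R * z%:R :> R by rewrite mulr_ge0.
move: h1 h2 l2 h3; rewrite expr2 -!mulrA; lra.
Qed.

Lemma summands_le (R : realFieldType) (x y t : R) : 2 <= x -> 0 <= y -> 0 <= t ->
  [/\ 2 <= x + y + t, x <= x + y + t, y <= x + y + t & t <= x + y + t].
Proof. by move=> *; split; lra. Qed.

(** * Passage to the limit *)

Theorem theorem4 (R : realType) (beta c : R) (hbeta : 0 < beta) (hc : 0 < c) :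
  exists delta : R, 0 < delta /\ delta < 1 /\
    (fun n : nat =>
       mu beta c
         (fun G : graph n =>
            [forall U : {set 'I_n},
               (#|U|%:R <= n%:R / 2 :> R) ==>
               ((1 - delta) * c * #|U|%:R * ln n%:R <= (cut_size G U)%:R)]))
      @ \oo --> (1 : R).
Proof.
(* Cuts exceed [z] times the size of [U], and [z] is at least [c ln n / 128]. *)
exists (1 - 128^-1); do 2![split; first by lra].
have [N NE] : exists N, N = (4 * 512 * 512)%N by eexists.
have e0 : 0 < expR 1 :> R by exact: expR_gt0.
apply/cvgrPdist_le => eps eps0.
(* The total error will be at most [C / z]. The summands of [Zm] ensure in turn that [rho <= 1/2],
   that [unbalanced_term_le] applies and that [C / z <= eps]; [K] is the bound asked for by
   [exists_scale]. *)
pose C := 2 + 6 * expR 1 : R.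
pose Zm : R := C + (1 + 256 / c) / (64 * beta) + C / eps.
pose K : R := 64 / c * (Zm + 1) + 8 * (c + 1) + 4 * N%:R * c.
near=> n.
have Kl : K <= ln (n%:R : R) by near: n; exact: near_ln_ge.
have C2 : 2 <= C by rewrite /C lerDl mulr_ge0 // ltW.
have b0 : 0 <= (1 + 256 / c) / (64 * beta).
  by rewrite divr_ge0 ?addr_ge0 ?divr_ge0 ?mulr_ge0 // ltW.
have eC0 : 0 <= C / eps by rewrite divr_ge0 ?ltW // (lt_le_trans _ C2).
have [Zm2 CZ bZ eZ] : [/\ 2 <= Zm, C <= Zm, (1 + 256 / c) / (64 * beta) <= Zm & C / eps <= Zm].
  exact: summands_le.
have [z [Zz lo hi n0 [cn zn]]] := exists_scale hc Zm2 Kl.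
have z2 : (2 <= z)%N by rewrite -(ler_nat R); exact: le_trans Zm2 Zz.
have z0 : (0 < z)%N by exact: ltnW.
have zR : 0 < z%:R :> R by rewrite ltr0n.
have zC := le_trans CZ Zz; have zb := le_trans bZ Zz; have zeps := le_trans eZ Zz.
have m_le := num_edges_le_bin (ltW hc) n0 cn.
have m_mean := num_edges_window (ltW hc) n0 z0 lo hi.
have rho_le : expR 1 * 2^-1 ^+ z./2.-1 <= 3 * expR 1 / z%:R :> R.
  rewrite [3 * _]mulrC -mulrA; apply: ler_wpM2l; first exact: ltW.
  exact: half_pow_le.
have rho2 : expR 1 * 2^-1 ^+ z./2.-1 <= 2^-1 :> R.
  apply: (le_trans rho_le); rewrite ler_pdivrMr //.
  by move: zC; rewrite /C; move: (expR 1) (z%:R) => a b; clear; lra.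
have term1 : n%:R ^+ 2 * expR (- (2 * beta * (8 * z)%:R)) ^+ (8 * z)./2 <= z%:R^-1 :> R.
  apply: unbalanced_term_le hi _ => //.
  by move: zb; rewrite ler_pdivrMr ?mulr_gt0 // [z%:R * _]mulrC.
set P := (X in mu _ _ X).
have le1 := @mu_le1 R beta c n P m_le.
rewrite NE in zn.
have ge1 := @mu_ge R beta c n z P (ltW hbeta) z2 m_le m_mean zn rho2.
(* As the measure is at most 1, only the lower bound [1 - eps] is left. *)
rewrite ger0_norm ?subr_ge0 ?le1 //.
rewrite lerBlDr -lerBlDl; apply: le_trans (ge1 _); last first.
  move=> G _ cuts; apply/forallP => U; apply/implyP.
  exact: cut_size_large hi cuts U.
rewrite lerB //; apply: (@le_trans _ _ (C / z%:R)); last first.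
  by rewrite ler_pdivrMr // mulrC -ler_pdivrMr.
have -> : C / z%:R = 2 * z%:R^-1 + 2 * (3 * expR 1 / z%:R) by rewrite /C; ring.
by apply: lerD; [rewrite -mulrA|]; apply: ler_wpM2l.
Unshelve. all: by end_near. Qed.
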